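(* Let $G$ be a graph. (a) If $\mathrm{mad}(G)<3$, then $\chi_o(G)\le 6$. (b) If $\mathrm{mad}(G)<20/7$, then $\chi_o(G)\le 5$. Furthermore, neither of these upper bounds on $\chi_o(G)$ can be decreased, and neither of the inequalities in the hypotheses can be weakened to allow equality; that is: there exists a graph $G$ with $\mathrm{mad}(G)<3$ and $\chi_o(G)=6$; there exists a graph $G$ with $\mathrm{mad}(G)<20/7$ and $\chi_o(G)=5$; there exists a graph $G$ with $\mathrm{mad}(G)=3$ and $\chi_o(G)>6$; and there exists a graph $G$ with $\mathrm{mad}(G)=20/7$ and $\chi_o(G)>5$.
   Context: All graphs are finite, simple and have at least one vertex. A proper coloring of a graph $G$ is called odd if every non-isolated vertex $v$ has some color that appears an odd number of times on its (open) neighborhood $N(v)$. The smallest number of colors in an odd coloring of $G$ is denoted $\chi_o(G)$. The maximum average degree of $G$ is $\mathrm{mad}(G):=\max_{H\subseteq G}2|E(H)|/|V(H)|$, the maximum being over all non-empty subgraphs $H$ of $G$. *)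

(* Defs.v *)
From mathcomp Require Import all_boot all_order all_algebra.

Set Implicit Arguments.
Unset Strict Implicit.
Unset Printing Implicit Defensive.

Import Order.TTheory GRing.Theory Num.Theory.

Record graph := Graph {
  vertex :> finType;
  adj : rel vertex;
  adj_sym : symmetric adj;
  adj_irr : irreflexive adj;
  vertex_gt0 : 0 < #|vertex|
}.

Definition nbhd (G : graph) (v : G) : {set G} := [set u | adj v u].

Definition edges (G : graph) : {set {set G}} :=
  [set [set p.1; p.2] | p : G * G & adj p.1 p.2].

(* A subgraph, not necessarily induced, is a pair (A, F) of a vertex set and
   an edge set. *)
Definition nonempty_subgraph (G : graph) (H : {set G} * {set {set G}}) : bool :=
  [&& H.1 != set0, H.2 \subset edges G & [forall e in H.2, e \subset H.1]].

Definition average_degree (G : graph) (H : {set G} * {set {set G}}) : rat :=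
  (2 * #|H.2|%:R / #|H.1|%:R)%R.

(* The default value 0 is harmless: average degrees are nonnegative and, G
   having a vertex, the range is inhabited. *)
Definition mad (G : graph) : rat :=
  \big[Num.max/0%R]_(H : {set G} * {set {set G}} | nonempty_subgraph H)
    average_degree H.

Definition proper_coloring (G : graph) (C : finType) (c : G -> C) : bool :=
  [forall u, forall v, adj u v ==> (c u != c v)].

Definition odd_coloring (G : graph) (C : finType) (c : G -> C) : bool :=
  proper_coloring c &&
  [forall v, (nbhd v != set0) ==>
     [exists a : C, odd #|[set u in nbhd v | c u == a]|]].

Definition odd_colorable (G : graph) (k : nat) : bool :=
  [exists c : {ffun G -> 'I_k}, odd_coloring c].

Lemma odd_colorable_card (G : graph) : odd_colorable G #|G|.
Proof.
apply/existsP; exists [ffun v => enum_rank v]; apply/andP; split.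
  apply/forallP => u; apply/forallP => v; apply/implyP => uv.
  rewrite !ffunE (inj_eq enum_rank_inj).
  by apply: contraTneq uv => ->; rewrite adj_irr.
apply/forallP => v; apply/implyP => /set0Pn[w wv].
apply/existsP; exists (enum_rank w).
suff -> : [set u in nbhd v | [ffun x => enum_rank x] u == enum_rank w]
          = [set w] by rewrite cards1.
apply/setP => u; rewrite !inE ffunE (inj_eq enum_rank_inj).
by case: eqP => [->|_]; rewrite ?andbF // andbT; rewrite inE in wv.
Qed.

Definition chi_o (G : graph) : nat :=
  ex_minn (ex_intro (odd_colorable G) #|G| (odd_colorable_card G)).

(* Main.v *)
Require Import Defs.
From mathcomp Require Import all_boot all_order all_algebra zify lra.

Set Implicit Arguments.
Unset Strict Implicit.
Unset Printing Implicit Defensive.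

Import Order.TTheory GRing.Theory Num.Theory.

(** Call a vertex of degree 2 a 2-vertex, and similarly for other degrees.

    Upper bounds.  If G needs more than k colours, take a vertex set D that is
    minimal among those whose induced subgraph has no odd k-colouring
    ([exists_critical]).  Its average degree is at most mad G ([mad_ge]), so it
    suffices to bound that degree from below, by 3 for k = 6
    ([critical_average3]) and by 20/7 for k = 5 ([critical_average20_7]).

    Both bounds come from a greedy extension of colourings.  A coloured vertex
    w forbids at most two colours to its neighbours: its own, and a colour that
    is odd at w, which is to remain so; it forbids only its own if its degree
    is odd, as the condition at w is then automatic ([odd_has_odd]).  A 2-vertex
    whose ends have distinct colours can thus always be coloured last when
    k >= 5, because at most 4 colours are forbidden ([color_postponed]).  Hence
    a 2-vertex acts like an edge: when v is coloured before its 2-neighbours,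
    each of them forbids v a single colour, that of its other end
    ([color_vertex]).  So if v has degree d, with t 2-neighbours and r
    neighbours of odd degree, it sees at most 2d - t - r forbidden colours, and
    minimality of D gives k + t + r <= 2d whenever the oddness condition at v
    is no obstacle ([critical_cost]).

    For k = 6 this leaves so few 2-neighbours to vertices of degree at most 5
    that letting every vertex give 1/2 to each 2-neighbour brings all degrees
    to at least 3.  For k = 5 every vertex gives 3/7 to each 2-neighbour.  The
    vertices that fall below 20/7 are the 3-vertices with one 2-neighbour and
    the 4-vertices with three; all their other neighbours have even degree at
    least 4, are not of this kind ([poor_nb]), and can afford to give them 1/7
    each.

    Sharpness.  Subdivide every edge of the complete graph on n vertices once.
    The ends of a subdivided edge need distinct colours, so at least n colours
    are needed ([chi_o_subdivided]), and the maximum average degree is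
    4 (n - 1) / (n + 1) ([mad_subdivided]): 8/3, 20/7 and 3 for n = 5, 6, 7.
    The upper bounds just proved give equality for n = 5 and n = 6. *)

(** * Odd colourings of induced subgraphs *)

Section OddOn.
Variables (G : graph) (C : finType).
Implicit Types (D X U S : {set G}) (c : G -> C) (u v w : G).

(** The neighbourhood of v in the subgraph induced by D.  The proof never
    leaves the ambient graph: an induced subgraph is only its vertex set. *)
Definition nb D v : {set G} := nbhd v :&: D.

Definition has_odd S c : bool := [exists a : C, odd #|[set u in S | c u == a]|].

Definition odd_on D c : bool :=
  [forall u in D, forall v in D, adj u v ==> (c u != c v)] &&
  [forall v in D, (nb D v != set0) ==> has_odd (nb D v) c].

Definition colorable D : bool := [exists c : {ffun G -> C}, odd_on D c].

Lemma in_nb D v u : (u \in nb D v) = adj v u && (u \in D).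
Proof. by rewrite !inE. Qed.

Lemma nb_sub D v : nb D v \subset D.
Proof. exact: subsetIr. Qed.

Lemma nbC D u v : u \in D -> v \in nb D u -> u \in nb D v.
Proof. by rewrite !in_nb adj_sym => -> /andP[->]. Qed.

Lemma eq_has_odd S c c' : {in S, c =1 c'} -> has_odd S c = has_odd S c'.
Proof.
move=> ecc'; apply: eq_existsb => a; congr (odd _); apply: eq_card => u.
by rewrite !inE; case: (boolP (u \in S)) => //= /ecc' ->.
Qed.

(** An odd sum has an odd summand; so vertices of odd degree satisfy every
    proper colouring, and this is what makes odd degrees cheap below. *)
Lemma odd_has_odd S c : odd #|S| -> has_odd S c.
Proof.
apply: contraLR => /existsPn noodd.
rewrite -sum1_card (partition_big c predT) //=.
rewrite (big_morph odd oddD (erefl _)) big1 // => a _.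
rewrite -[RHS](negbTE (noodd a)) -sum1_card; congr odd.
by apply: eq_bigl => u; rewrite !inE.
Qed.

Lemma inj_has_odd S c : {in S &, injective c} -> S != set0 -> has_odd S c.
Proof.
move=> injc /set0Pn[w wS]; apply/existsP; exists (c w).
suff -> : [set u in S | c u == c w] = [set w] by rewrite cards1.
apply/setP => u; rewrite !inE; apply/andP/eqP => [[uS /eqP]|->]; last by rewrite eqxx.
by apply: injc.
Qed.

Lemma odd_onP D c :
  reflect ((forall u v, u \in D -> v \in D -> adj u v -> c u != c v) /\
           (forall v, v \in D -> nb D v != set0 -> has_odd (nb D v) c))
          (odd_on D c).
Proof.
apply: (iffP andP) => -[prop_c odd_c]; split.
- move=> u v uD vD; apply/implyP; move/forall_inP: prop_c => /(_ u uD).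
  by move/forall_inP; apply.
- by move=> v vD; apply/implyP; move/forall_inP: odd_c; apply.
- by apply/forall_inP => u uD; apply/forall_inP => v vD; apply/implyP; apply: prop_c.
- by apply/forall_inP => v vD; apply/implyP; apply: odd_c.
Qed.

Lemma colorableP D : reflect (exists c, odd_on D c) (colorable D).
Proof.
apply: (iffP existsP) => -[c]; first by exists c.
move=> /odd_onP[prop_c odd_c]; exists (finfun c); apply/odd_onP; split=> [u v|v vD nbv].
  by rewrite !ffunE; apply: prop_c.
by rewrite (@eq_has_odd _ _ c) ?odd_c // => u _; rewrite ffunE.
Qed.

(** * Extending a partial colouring *)

Section Partial.
Variable D : {set G}.
Local Notation d v := #|nb D v|.

(** The invariant kept while the vertices of D are coloured one at a time,
    with X coloured so far.  The oddness condition is imposed only where it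
    is not automatic in the end, at vertices of even degree in D.  The set U
    contains 2-vertices whose colouring is postponed: the third clause keeps
    the two ends of each of them apart, which is exactly what the oddness
    condition at a 2-vertex asks. *)
Definition partial_coloring U X c : Prop :=
  [/\ forall u v, u \in X -> v \in X -> adj u v -> c u != c v,
      forall v, v \in X -> ~~ odd (d v) -> nb X v != set0 -> has_odd (nb X v) c
    & forall u, u \in U -> {in nb X u &, injective c}].

Definition cost X w : nat := if odd (d w) || (nb X w == set0) then 1 else 2.

(** The default [c w] is forbidden by w anyway, so it adds no constraint when
    no colour is odd at w. *)
Definition odd_color X c w : C :=
  odflt (c w) [pick a | odd #|[set u in nb X w | c u == a]|].

(** What w forbids to a neighbour about to be coloured: its own colour, and
    one colour that is odd at w, so that this colour stays odd.  The second
    is superfluous if w has odd degree, or if w has no coloured neighbour,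
    since the new colour will then be the odd one. *)
Definition forbidden X c w : {set C} :=
  if odd (d w) || (nb X w == set0) then [set c w] else [set c w; odd_color X c w].

Lemma card_forbidden X c w : #|forbidden X c w| <= cost X w.
Proof.
by rewrite /forbidden /cost; case: ifP => _; rewrite ?cards1 // cards2; case: eqP.
Qed.

Lemma nb_setU1 X v w :
  nb (v |: X) w = if adj w v then v |: nb X w else nb X w.
Proof.
apply/setP => x; case: ifP => wv; rewrite ?inE; case: (x =P v) => [->|_] //=.
  by rewrite wv.
by rewrite wv.
Qed.

Lemma card_bigcup_le (I T : finType) (A : {set I}) (F : I -> {set T}) :
  #|\bigcup_(i in A) F i| <= \sum_(i in A) #|F i|.
Proof.
elim/big_rec2: _ => [|i n S _ leSn]; first by rewrite cards0.
by apply: leq_trans (leq_card_setU _ _) _; rewrite leq_add2l.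
Qed.

(** The greedy step.  Each coloured neighbour w of v forbids at most [cost]
    colours, and each postponed neighbour of v forbids the colour of its other
    end. *)
Lemma color_vertex U X c v :
    partial_coloring U X c -> v \notin X ->
    {in U, forall u, adj v u -> #|nb X u| <= 1} ->
    [|| odd (d v), nb X v == set0 | has_odd (nb X v) c] ->
    #|nb U v| + \sum_(w in nb X v) cost X w < #|C| ->
  exists c', partial_coloring U (v |: X) c'.
Proof.
move=> [prop_c odd_c inj_c] vX U1 odd_v small.
pose F := (\bigcup_(u in nb U v) c @: nb X u) :|: \bigcup_(w in nb X v) forbidden X c w.
have /set0Pn[a]: ~: F != set0.
  rewrite -card_gt0 cardsCs setCK subn_gt0; apply: leq_ltn_trans small.
  apply: leq_trans (leq_card_setU _ _) _; apply: leq_add.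
    apply: leq_trans (card_bigcup_le _ _) _; rewrite -sum1_card; apply: leq_sum => u.
    rewrite in_nb => /andP[vu uU]; exact: leq_trans (leq_imset_card _ _) (U1 u uU vu).
  apply: leq_trans (card_bigcup_le _ _) _.
  by apply: leq_sum => w _; apply: card_forbidden.
rewrite !inE negb_or => /andP[/bigcupP aU /bigcupP aX].
have ac w : w \in nb X v -> a != c w.
  move=> wX; apply: contra_notN aX => /eqP ->; exists w => //.
  by rewrite /forbidden; case: ifP; rewrite !inE eqxx.
pose c' := [eta c with v |-> a].
have c'X w : w \in X -> c' w = c w.
  by move=> wX /=; case: eqP vX => // <-; rewrite wX.
have c'v : c' v = a by rewrite /= eqxx.
have c'nb w : {in nb X w, c' =1 c}.
  by move=> x; rewrite in_nb => /andP[_] /c'X.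
have vnb w : v \notin nb X w by rewrite in_nb (negbTE vX) andbF.
exists c'; split.
- move=> u w; rewrite !in_setU1 => /predU1P[->|uX] /predU1P[->|wX] uw.
  + by rewrite adj_irr in uw.
  + by rewrite c'v (c'X w) // ac // in_nb uw.
  + by rewrite c'v (c'X u) // eq_sym ac // in_nb adj_sym uw.
  + by rewrite !c'X // prop_c.
- move=> w; rewrite in_setU1 => /predU1P[->|wX] even_w.
    rewrite nb_setU1 adj_irr (eq_has_odd (c'nb v)) => nbv.
    by move: odd_v; rewrite (negbTE even_w) (negbTE nbv).
  rewrite nb_setU1; case: ifP => [wv _|_ nbw]; last first.
    by rewrite (eq_has_odd (c'nb w)) odd_c.
  have [nbw|nbw] := eqVneq (nb X w) set0.
    by rewrite nbw setU0 odd_has_odd ?cards1.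
  have [b oddb] := existsP (odd_c w wX even_w nbw).
  have: a \notin forbidden X c w.
    by apply: contra_notN aX => aw; exists w => //; rewrite in_nb adj_sym wv.
  rewrite /forbidden (negbTE even_w) (negbTE nbw) /= !inE negb_or => /andP[_].
  rewrite /odd_color; case: pickP => [e odde /= ae|/(_ b)]; last by rewrite oddb.
  apply/existsP; exists e.
  rewrite (_ : [set u in _ | _] = [set u in nb X w | c u == e]) //.
  apply/setP => x; rewrite [LHS]in_set [RHS]in_set in_setU1.
  have [->|_] := eqVneq x v; first by rewrite (negbTE (vnb w)) c'v (negbTE ae).
  by have [/c'nb ->|] := boolP (x \in nb X w).
- move=> u uU; rewrite nb_setU1; case: ifP => uv; last first.
    by move=> x y xu yu; rewrite !(c'nb u) //; apply: (inj_c u uU).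
  have auv x : x \in nb X u -> a != c x.
    move=> xu; apply: contra_notN aU => /eqP ->; exists u; last exact: imset_f.
    by rewrite in_nb adj_sym uv.
  move=> x y; rewrite !in_setU1 => /predU1P[->|xu] /predU1P[->|yu] //.
  + by rewrite c'v (c'nb u) // => /eqP; rewrite (negbTE (auv y yu)).
  + by rewrite c'v (c'nb u) // => /esym/eqP; rewrite (negbTE (auv x xu)).
  + by rewrite !(c'nb u) //; apply: (inj_c u uU).
Qed.

(** With five colours the postponed 2-vertices can be coloured in any order:
    each has two neighbours, both coloured and of distinct colours, and these
    forbid at most four colours. *)
Lemma color_postponed U X c :
    5 <= #|C| -> partial_coloring U X c -> D = X :|: U -> [disjoint X & U] ->
    {in U, forall u, #|nb D u| = 2 /\ nb D u \subset X} ->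
  colorable D.
Proof.
move=> C5; move: {2}#|U| (erefl #|U|) => n.
elim: n U X c => [|n IHn] U X c cardU part_c defD XU U2.
  have U0 : U = set0 by apply/eqP; rewrite -cards_eq0 cardU.
  rewrite {}U0 setU0 in defD; rewrite -{}defD in part_c.
  case: part_c => prop_c odd_c _.
  apply/colorableP; exists c; apply/odd_onP; split=> // v vD nbv.
  by have [/odd_has_odd|/odd_c] := boolP (odd (d v)); apply.
have [u uU] : exists u, u \in U by apply/set0Pn; rewrite -card_gt0 cardU.
have [du uX] := U2 u uU.
have nbX : nb X u = nb D u.
  apply/setP => x; rewrite !in_nb; have [ux|//] := boolP (adj u x).
  apply/idP/idP => /= [xX|xD]; first by rewrite defD inE xX.
  by rewrite (subsetP uX) // in_nb ux.
have noU u' : u' \in U -> ~~ adj u u'.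
  move=> u'U; apply/negP => uu'.
  have : u' \in nb D u by rewrite in_nb uu' defD inE u'U orbT.
  by move/(subsetP uX) => u'X; rewrite (disjointFr XU) in u'U.
have uX' : u \notin X by apply: contraTN uU => uX'; rewrite (disjointFr XU).
case: part_c => prop_c odd_c inj_c.
have [|//||||c' part_c'] := @color_vertex (U :\ u) X c u.
- by split=> // u' /setD1P[_]; apply: inj_c.
- by move=> u' /setD1P[_ /noU/negbTE ->].
- by rewrite inj_has_odd ?orbT //; [apply: inj_c | rewrite nbX -card_gt0 du].
- rewrite (_ : nb _ u = set0) ?cards0; last first.
    apply/setP => x; rewrite in_nb !inE; apply/negbTE/negP => /and3P[ux _ /noU].
    by rewrite ux.
  apply: leq_trans C5; rewrite ltnS.
  have -> : 4 = \sum_(w in nb X u) 2 by rewrite sum_nat_const nbX du.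
  by apply: leq_sum => w _; rewrite /cost; case: ifP.
apply: (IHn (U :\ u) (u |: X) c') => //.
- by move: cardU; rewrite (cardsD1 u) uU => -[].
- by rewrite defD -setUA setUCA setD1K // setUC setUA [_ :|: X]setUC.
- rewrite disjoints_subset; apply/subsetP => x; rewrite !inE.
  case: eqP => //= _ xX; by rewrite (disjointFr XU).
- move=> u' /setD1P[_ /U2[-> sub]]; split=> //.
  exact: subset_trans sub (subsetUr _ _).
Qed.

End Partial.
End OddOn.

(** * Reducible configurations in a minimal uncolourable graph *)

Section Critical.
Variables (G : graph) (C : finType) (D : {set G}).
Hypotheses (C_ge5 : 5 <= #|C|) (D_uncol : ~~ colorable C D).
Hypothesis D_min : forall X : {set G}, X \proper D -> colorable C X.
Implicit Types (X U : {set G}) (u v w : G).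
Local Notation d v := #|nb D v|.

Definition twos v := [set u in nb D v | d u == 2].
Definition odds v := [set u in nb D v | odd (d u)].

(** If every vertex of U has at most one end in X, its ends cannot clash yet,
    so any odd colouring of X starts the greedy procedure. *)
Lemma colorable_partial U X :
  colorable C X -> {in U, forall u, #|nb X u| <= 1} ->
  exists c : G -> C, partial_coloring D U X c.
Proof.
move=> /colorableP[c /odd_onP[prop_c odd_c]] U1; exists c; split=> // [v vX _|u uU x y].
  exact: odd_c.
by move/card_le1_eqP: (U1 u uU) => nb1 xu yu _; apply: nb1.
Qed.

Lemma card_nb_without X u x :
  d u = 2 -> x \in nb D u -> X \subset D -> x \notin X -> #|nb X u| <= 1.
Proof.
move=> du xu XD xX; rewrite -ltnS -{1}du; apply/proper_card/properP; split.
  by apply/subsetP => y; rewrite !in_nb => /andP[-> /(subsetP XD)].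
by exists x => //; rewrite in_nb (negbTE xX) andbF.
Qed.

(** Delete v and some of its 2-neighbours U, colour the rest by minimality,
    then colour v, then U.  Colouring v succeeds unless the colours forbidden
    by its neighbours exhaust C.  The parity hypothesis covers the oddness
    condition at v itself: it is automatic if v has odd degree, is void when
    all neighbours of v are postponed, and holds already when an odd number of
    them is coloured. *)
Lemma star_cost v U :
    v \in D -> U \subset twos v -> {in U &, forall u u', ~~ adj u u'} ->
    [|| odd (d v), nb D v \subset U | odd #|nb D v :\: U|] ->
  #|C| <= #|U| + \sum_(w in nb D v :\: U) (if odd (d w) then 1 else 2).
Proof.
move=> vD /subsetP U2 indepU odd_v; rewrite leqNgt; apply/negP => small.
have vnb u : u \in U -> adj v u && (u \in D).
  by move=> /U2; rewrite inE => /andP[]; rewrite in_nb.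
have dU u : u \in U -> d u = 2 by move=> /U2; rewrite inE => /andP[_ /eqP].
pose X := D :\: (v |: U).
have XD : X \subset D by apply: subsetDl.
have vX : v \notin X by rewrite !inE eqxx.
have nbu u : u \in U -> v \in nb D u.
  by move=> /vnb; rewrite in_nb adj_sym vD andbT => /andP[].
have nbX1 : {in U, forall u, #|nb X u| <= 1}.
  by move=> u uU; apply: card_nb_without (dU u uU) (nbu u uU) XD vX.
have nbXv : nb X v = nb D v :\: U.
  apply/setP => x; rewrite in_nb in_setD in_nb !inE negb_or.
  have [->|_] /= := eqVneq x v; first by rewrite adj_irr /= andbF.
  by rewrite andbCA.
have [|c part_c] := @colorable_partial U X _ nbX1.
  by apply: D_min; apply/properP; split=> //; exists v.
have [|||c' part_c'] := color_vertex part_c vX.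
- by move=> u uU _; apply: nbX1.
- case/or3P: odd_v => [->//|vU|odd_v]; last by rewrite odd_has_odd ?orbT // nbXv.
  by rewrite nbXv setD_eq0 vU orbT.
- apply: leq_ltn_trans small; rewrite nbXv leq_add //.
    by rewrite subset_leq_card // nb_sub.
  by apply: leq_sum => w _; rewrite /cost; case: (odd _) => //; case: ifP.
case/negP: D_uncol; apply: (color_postponed C_ge5 part_c').
- apply/setP => x; rewrite !inE; have [->|_] /= := eqVneq x v; first by rewrite vD.
  by case: (boolP (x \in U)) => [/vnb/andP[_ ->]|_]; rewrite ?orbF.
- rewrite disjoints_subset; apply/subsetP => x; rewrite !inE => /predU1P[->|].
    by apply/negP => /vnb; rewrite adj_irr.
  by rewrite negb_or => /andP[/andP[]].
move=> u uU; split; first exact: dU.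
apply/subsetP => x; rewrite in_nb !inE => /andP[ux ->].
case: eqP => //= _; rewrite andbT.
by apply: contraTN ux => xU; apply: indepU.
Qed.

Lemma critical_degree_ge2 v : v \in D -> 2 <= d v.
Proof.
move=> vD; rewrite leqNgt; apply/negP => dv.
have par : [|| odd (d v), nb D v \subset set0 | odd #|nb D v :\: set0|].
  rewrite subset0 -cards_eq0.
  by move: #|nb D v| dv => [|[]].
have indep : {in set0 &, forall u u' : G, ~~ adj u u'} by move=> u u'; rewrite inE.
have := leq_trans C_ge5 (star_cost vD (sub0set _) indep par).
apply/negP; rewrite -ltnNge cards0 setD0 add0n ltnS.
apply: leq_trans (_ : \sum_(w in nb D v) 2 <= _).
  by apply: leq_sum => w _; case: ifP.
by rewrite sum_nat_const; lia.
Qed.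

(** Take U = {u} in [star_cost]: v has a single other neighbour, so at most
    three colours are forbidden. *)
Lemma twos_nonadjacent v u : v \in D -> u \in nb D v -> d v = 2 -> d u != 2.
Proof.
move=> vD uv dv; apply/eqP => du.
have cardD : #|nb D v :\: [set u]| = 1.
  by move: dv; rewrite (cardsD1 u) uv => -[].
have u2 : [set u] \subset twos v by rewrite sub1set inE uv du eqxx.
have indep : {in [set u] &, forall x y : G, ~~ adj x y}.
  by move=> x y /set1P -> /set1P ->; rewrite adj_irr.
have par : [|| odd (d v), nb D v \subset [set u] | odd #|nb D v :\: [set u]|].
  by rewrite cardD !orbT.
have := leq_trans C_ge5 (star_cost vD u2 indep par).
apply/negP; rewrite -ltnNge ltnS cards1.
apply: leq_trans (_ : 1 + \sum_(w in nb D v :\: [set u]) 2 <= _).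
  by rewrite leq_add2l; apply: leq_sum => w _; case: ifP.
by rewrite sum_nat_const cardD.
Qed.

Lemma twos_indep v : {in twos v &, forall u u', ~~ adj u u'}.
Proof.
move=> u u'; rewrite !inE => /andP[/andP[_ uD] /eqP du] /andP[/andP[_ u'D] /eqP du'].
apply/negP => uu'; have := @twos_nonadjacent u u' uD; rewrite in_nb uu' u'D.
by move=> /(_ isT du); rewrite du'.
Qed.

(** The case where all 2-neighbours are postponed.  A neighbour of v costs 1
    if it is a 2-vertex or of odd degree, and 2 otherwise. *)
Lemma critical_cost v : v \in D ->
    [|| odd (d v), #|twos v| == d v | odd (d v - #|twos v|)] ->
  #|C| + #|twos v| + #|odds v| <= 2 * d v.
Proof.
move=> vD par.
have sub2 : twos v \subset nb D v by apply/subsetP => u; rewrite inE => /andP[].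
have cardD : #|nb D v :\: twos v| = d v - #|twos v| by rewrite cardsDS.
have sum_cost : \sum_(w in nb D v :\: twos v) (if odd (d w) then 1 else 2) + #|odds v|
    = 2 * (d v - #|twos v|).
  rewrite -cardD mulnC -sum_nat_const.
  rewrite (_ : #|odds v| = \sum_(w in nb D v :\: twos v) odd (d w)).
    by rewrite -big_split; apply: eq_bigr => w _; case: odd.
  rewrite -sum1_card big_mkcond [RHS]big_mkcond; apply: eq_bigr => w _; rewrite !inE.
  by case: (adj v w); case: (w \in D) => //=; case: eqP => [->|_] //=; case: odd.
have := @star_cost v (twos v) vD (subxx _) (@twos_indep v).
have -> : nb D v \subset twos v = (#|twos v| == d v).
  apply/idP/eqP => [sub|eqc]; first by apply/eqP; rewrite eqn_leq !subset_leq_card.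
  by move/subset_leqif_cards: sub2 => [_]; rewrite eqc eqxx => /esym/eqP ->.
rewrite cardD => /(_ par).
have := subset_leq_card sub2; lia.
Qed.

(** Postpone the 2-neighbours of both vertices.  Then v sees no coloured
    vertex and three postponed ones, so it avoids three colours; v' avoids
    three for the same reason and the colour of v, which is the only coloured
    neighbour of v'.  The two vertices may share 2-neighbours. *)
Lemma three_two_fours_nonadjacent v v' : v \in D -> v' \in nb D v ->
  d v = 4 -> #|twos v| = 3 -> d v' = 4 -> #|twos v'| != 3.
Proof.
move=> vD vv' dv tv dv'; apply/eqP => tv'.
have other x y : y \in nb D x -> d x = 4 -> #|twos x| = 3 -> d y = 4 ->
    nb D x = y |: twos x.
  move=> xy dx tx dy; apply/esym/eqP; rewrite eqEcard; apply/andP; split.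
    by apply/subsetP => z /setU1P[->//|]; rewrite inE => /andP[].
  by rewrite cardsU1 inE xy dy dx tx.
have v'v := nbC vD vv'.
have nbv := other v v' vv' dv tv dv'; have nbv' := other v' v v'v dv' tv' dv.
have /andP[adjvv' v'D] : adj v v' && (v' \in D) by rewrite -in_nb.
pose U := twos v :|: twos v'; pose X := D :\: (v |: (v' |: U)).
have XD : X \subset D by apply: subsetDl.
have vX : v \notin X by rewrite !inE eqxx.
have v'X : v' \notin X by rewrite !inE eqxx orbT.
have v_v' : v' != v by apply: contraTneq adjvv' => ->; rewrite adj_irr.
have dU u : u \in U -> d u = 2 by rewrite !inE -andb_orl => /andP[_ /eqP].
have nbX1 y u : y \in D -> y \notin X -> u \in U -> adj y u -> #|nb X u| <= 1.
  move=> yD yX /dU du yu; apply: (@card_nb_without _ _ y) => //.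
  by rewrite in_nb adj_sym yu.
have [||c part_c] := @colorable_partial U X.
- by apply: D_min; apply/properP; split=> //; exists v.
- move=> u uU; move: (uU); rewrite !inE => /orP[] /andP[/andP[yu _] _].
    exact: (nbX1 v).
  exact: (nbX1 v').
have nbXv : nb X v = set0.
  apply/setP => x; rewrite in_nb !inE; apply/negbTE/negP => /andP[vx /andP[]].
  rewrite !negb_or => /and4P[_ xv' xt _] xD.
  have : x \in nb D v by rewrite in_nb vx.
  by rewrite nbv !inE (negbTE xv') (negbTE xt).
have nbUx x : nb U x \subset twos x.
  apply/subsetP => u; rewrite in_nb => /andP[xu uU]; rewrite inE in_nb xu dU //.
  by move: uU; rewrite !inE => /orP[] /andP[/andP[_ ->]].
have [|||c1 part_c1] := color_vertex part_c vX.
- by move=> u uU; apply: nbX1.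
- by rewrite nbXv eqxx orbT.
- rewrite nbXv big_set0 addn0; apply: leq_ltn_trans (leq_trans _ C_ge5).
    exact: subset_leq_card (nbUx v).
  by rewrite tv.
have nbX1v' : nb (v |: X) v' = [set v].
  rewrite nb_setU1 adj_sym adjvv'; apply/setP => x; rewrite in_setU1 in_nb !inE.
  case: eqP => //= xv; apply/negbTE/negP => /andP[vx /andP[]].
  rewrite !negb_or => /and3P[_ _ xt] xD.
  have : x \in nb D v' by rewrite in_nb vx.
  by rewrite nbv' !inE (negbTE xt) orbF => /eqP.
have v'vX : v' \notin v |: X by rewrite in_setU1 negb_or v_v'.
have [|||c2 part_c2] := color_vertex part_c1 v'vX.
- move=> u uU v'u; apply: (@card_nb_without _ _ v') => //; first exact: dU.
    by rewrite in_nb adj_sym v'u.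
  by rewrite subUset sub1set vD.
- by rewrite odd_has_odd ?orbT // nbX1v' cards1.
- rewrite nbX1v' big_set1 /cost nb_setU1 adj_irr nbXv eqxx orbT addn1.
  apply: leq_trans C_ge5; rewrite !ltnS -tv'.
  exact: subset_leq_card (nbUx v').
case/negP: D_uncol; apply: (color_postponed C_ge5 part_c2).
- apply/setP => x; rewrite !in_setU !in_set1 in_setD !in_setU !in_set1.
  have [->|_] /= := eqVneq x v; first by rewrite orbT vD.
  have [->|_] /= := eqVneq x v'; first by rewrite v'D.
  rewrite -in_setU -/U; case: (boolP (x \in U)) => [|_]; last by rewrite orbF.
  by rewrite !inE => /orP[] /andP[/andP[_ ->]].
- rewrite disjoints_subset; apply/subsetP => x; rewrite 2!in_setU1 in_setD in_setC.
  case/or3P => [/eqP->|/eqP->|]; last by rewrite !in_setU1 !negb_or => /andP[/and3P[]].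
    by apply: contra_eqN dv' => /dU ->.
  by apply: contra_eqN dv => /dU ->.
move=> u uU; split; first exact: dU.
apply/subsetP => x; rewrite in_nb => /andP[ux xD]; rewrite !in_setU1 in_setD !in_setU1 xD.
case: eqP => //= _; case: eqP => //= _; rewrite andbT.
apply/negP => xU; have uD : u \in D by move: uU; rewrite !inE => /orP[] /andP[/andP[]].
by have := @twos_nonadjacent u x uD; rewrite in_nb ux xD !dU // => /(_ isT erefl).
Qed.

End Critical.

(** * Discharging *)

Section Discharging.
Variables (G : graph) (C : finType) (D : {set G}).
Hypotheses (C_ge5 : 5 <= #|C|) (D_uncol : ~~ colorable C D).
Hypothesis D_min : forall X : {set G}, X \proper D -> colorable C X.
Implicit Types (u v w : G).
Local Notation d v := #|nb D v|.
Local Notation t v := #|twos D v|.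

Lemma double_count (Q R : pred G) :
  \sum_(v in D | Q v) #|[set u in nb D v | R u]| =
  \sum_(u in D | R u) #|[set v in nb D u | Q v]|.
Proof.
under eq_bigr do rewrite -sum1_card.
under [RHS]eq_bigr do rewrite -sum1_card.
rewrite (exchange_big_dep (fun u => (u \in D) && R u)) /=; last first.
  by move=> v u _; rewrite !inE => /andP[/andP[_ ->] ->].
apply: eq_bigr => u /andP[uD Ru]; apply: eq_bigl => v.
by rewrite !inE uD Ru !andbT [adj v u]adj_sym andbC andbA.
Qed.

(** Both sides count the pairs of a vertex and one of its 2-neighbours. *)
Lemma sum_twos : \sum_(v in D) t v = \sum_(v in D | d v == 2) 2.
Proof.
transitivity (\sum_(v in D | predT v) #|[set u in nb D v | d u == 2]|).
  by apply: eq_bigl => v; rewrite andbT.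
rewrite double_count; apply: eq_bigr => u /andP[_ /eqP <-].
by apply: eq_card => v; rewrite !inE andbT.
Qed.

Lemma twos0 v : v \in D -> d v = 2 -> t v = 0.
Proof.
move=> vD dv; apply/eqP; rewrite cards_eq0; apply/eqP/setP => u.
rewrite in_set0 inE; apply/negbTE/negP => /andP[uv du].
by have := twos_nonadjacent C_ge5 D_uncol D_min vD uv dv; rewrite du.
Qed.

Lemma twos_le v : t v <= d v.
Proof. by apply/subset_leq_card/subsetP => u; rewrite inE => /andP[]. Qed.

Lemma sum_mul k (F : G -> nat) :
  \sum_(v in D) k * F v = k * \sum_(v in D) F v.
Proof. by rewrite big_distrr. Qed.

(** The charge of a vertex is at first its degree; then each 2-vertex receives
    1/2 from each neighbour.  By [twos_nonadjacent] a 2-vertex gives nothing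
    away; by [critical_cost] a 3-vertex has no 2-neighbour, a 4-vertex at most
    two and a 5-vertex at most four.  So every vertex ends with charge at least
    3.  The local inequality below is this statement, doubled. *)
Lemma critical_average3 : #|C| = 6 -> 3 * #|D| <= \sum_(v in D) d v.
Proof.
move=> C6.
have local v : v \in D -> 6 + t v <= 2 * d v + (if d v == 2 then 2 else 0).
  move=> vD; have := critical_degree_ge2 C_ge5 D_uncol D_min vD; have := twos_le v.
  have := critical_cost C_ge5 D_uncol D_min vD; rewrite C6.
  have [dv|] := eqVneq (d v) 2; first by rewrite (twos0 vD dv) dv.
  by lia.
have := leq_sum (index_enum G) local.
rewrite big_split [X in _ <= X -> _]big_split /= sum_twos -big_mkcondr /=.
by rewrite sum_nat_const sum_mul; lia.
Qed.

(** The vertices of a critical graph that fall below 20/7 after giving 3/7 to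
    each 2-neighbour: their deficit is 1/7 for each other neighbour. *)
Definition poor v := (d v == 3) && (t v == 1) || (d v == 4) && (t v == 3).

(** For poor vertices [critical_cost] is tight and leaves no room for a
    neighbour of odd degree; two adjacent poor vertices would then both be
    4-vertices, against [three_two_fours_nonadjacent]. *)
Lemma poor_nb v u : #|C| = 5 -> v \in D -> poor v -> u \in nb D v ->
  d u = 2 \/ ~~ odd (d u) /\ ~~ poor u.
Proof.
move=> C5 vD poor_v uv.
have even x y : x \in D -> poor x -> y \in nb D x -> ~~ odd (d y).
  move=> xD poor_x yx; have : #|odds D x| = 0.
    have := critical_cost C_ge5 D_uncol D_min xD.
    by case/orP: poor_x => /andP[/eqP-> /eqP->]; rewrite C5 => /(_ isT); lia.
  move/eqP; rewrite cards_eq0 => /eqP/setP/(_ y).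
  by rewrite in_set0 inE yx => /negbT.
have vu := nbC vD uv.
have uD : u \in D := subsetP (nb_sub D v) u uv.
have [|du2] := eqVneq (d u) 2; [by left | right].
split; first exact: even uv.
apply/negP => poor_u; have := even u v uD poor_u vu; have := even v u vD poor_v uv.
case/orP: poor_u => /andP[/eqP du /eqP tu]; rewrite du //= => _.
case/orP: poor_v => /andP[/eqP dv /eqP tv]; rewrite dv //= => _.
by have := three_two_fours_nonadjacent C_ge5 D_uncol D_min vD uv dv tv du; rewrite tu.
Qed.

(** Each vertex starts with its degree as charge.  Each 2-vertex receives 3/7
    from each neighbour, then each poor vertex receives 1/7 from each neighbour
    that is not a 2-vertex.  The local inequality says, multiplied by 7, that
    every vertex ends with charge at least 20/7: with s poor neighbours it
    gives s/7 unless it is a 2-vertex, and with m neighbours other than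
    2-vertices it receives m/7 if it is poor. *)
Lemma critical_average20_7 : #|C| = 5 -> 20 * #|D| <= 7 * \sum_(v in D) d v.
Proof.
move=> C5.
pose s v := #|[set u in nb D v | poor u]|; pose m v := #|[set u in nb D v | d u != 2]|.
have poor_not2 v : poor v -> d v != 2 by case/orP => /andP[/eqP->].
have nb_split v : t v + m v = d v.
  rewrite -(cardsID [set u | d u == 2] (nb D v)); congr (_ + _); apply: eq_card => u.
    by rewrite !inE.
  by rewrite !inE andbC.
have s_le v : s v <= m v.
  apply/subset_leq_card/subsetP => u; rewrite inE => /andP[uv /poor_not2 du].
  by rewrite inE uv.
have s0 v : v \in D -> d v != 2 -> odd (d v) || poor v -> s v = 0.
  move=> vD dv odd_poor; apply/eqP; rewrite cards_eq0; apply/eqP/setP => u.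
  rewrite in_set0 inE; apply/negbTE/negP => /andP[uv poor_u].
  have uD : u \in D := subsetP (nb_sub D v) u uv.
  case: (poor_nb C5 uD poor_u (nbC vD uv)) => [/eqP|[/negbTE odd_v /negbTE poor_v]].
    by rewrite (negbTE dv).
  by rewrite odd_v poor_v in odd_poor.
have local v : v \in D ->
    20 + 3 * t v + (if d v != 2 then s v else 0) <=
    7 * d v + (if d v == 2 then 6 else 0) + (if poor v then m v else 0).
  move=> vD; have := critical_degree_ge2 C_ge5 D_uncol D_min vD.
  have := critical_cost C_ge5 D_uncol D_min vD; rewrite C5.
  have := s0 v vD; have := nb_split v; have := s_le v.
  have [dv|] := eqVneq (d v) 2; first by rewrite (twos0 vD dv) /poor dv.
  by rewrite /poor /=; case: ifP; lia.
have := leq_sum (index_enum G) local.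
rewrite 2!big_split 2![in X in _ <= X -> _]big_split /= -!big_mkcondr !sum_mul /=.
rewrite sum_twos (double_count (fun v => d v != 2) poor) sum_nat_const.
rewrite (_ : \sum_(v in D | d v == 2) 6 = 3 * \sum_(v in D | d v == 2) 2);
  last by rewrite big_distrr.
by rewrite /m; lia.
Qed.

End Discharging.

(** * Maximum average degree through degree sums *)

Section MaximumAverageDegree.
Variable G : graph.
Implicit Types (A : {set G}).

Definition induced_edges A : {set {set G}} := [set e in edges G | e \subset A].

Lemma edge_eq (u v w : G) : adj u w -> [set u; v] = [set u; w] -> v = w.
Proof.
move=> uw /setP/(_ w); rewrite !inE eqxx orbT => /orP[/eqP wu|/eqP //].
by rewrite wu adj_irr in uw.
Qed.

Lemma handshake A : \sum_(v in A) #|nb A v| = 2 * #|induced_edges A|.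
Proof.
have edge_at v : v \in A -> #|nb A v| = \sum_(e in induced_edges A) (v \in e).
  move=> vA; rewrite -big_mkcondr /= sum1dep_card.
  rewrite -(card_in_imset (f := fun u => [set v; u])) => [|x y]; last first.
    by rewrite !in_nb => _ /andP[vy _]; apply: edge_eq.
  apply: eq_card => e; rewrite inE; apply/imsetP/andP => [[u]|].
    rewrite in_nb => /andP[vu uA] ->; split; last by rewrite !inE eqxx.
    rewrite inE subUset !sub1set vA uA !andbT.
    by apply/imsetP; exists (v, u); rewrite ?inE.
  rewrite inE => -[/andP[/imsetP[[x y]]]]; rewrite inE /= => xy ->.
  rewrite subUset !sub1set !inE => /andP[xA yA] /orP[] /eqP ->.
    by exists y; rewrite // in_nb xy.
  by exists x; [rewrite in_nb adj_sym xy | exact: setUC].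
rewrite (eq_bigr _ edge_at) exchange_big /= mulnC -sum_nat_const.
apply: eq_bigr => e; rewrite inE => /andP[/imsetP[[x y]]]; rewrite inE /= => xy -> sub.
have -> : 2 = #|[set x; y]| by rewrite cards2; case: eqP xy => // ->; rewrite adj_irr.
rewrite -sum1_card big_mkcond [RHS]big_mkcond; apply: eq_bigr => v _.
have [vA|vA] := boolP (v \in A); first by case: (v \in _).
by case: ifP => // /(subsetP sub); rewrite (negbTE vA).
Qed.

Lemma mad_ge A : A != set0 ->
  ((\sum_(v in A) #|nb A v|)%:R / #|A|%:R <= mad G)%R.
Proof.
move=> A0; rewrite handshake natrM.
apply: (le_bigmax_cond (j := (A, induced_edges A)) 0%R (@average_degree G)).
apply/and3P; split=> //=.
  by apply/subsetP => e; rewrite inE => /andP[].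
by apply/forall_inP => e; rewrite inE => /andP[].
Qed.

(** A subgraph with vertex set A has at most the edges of the induced one, so
    the maximum is attained at induced subgraphs. *)
Lemma mad_le (q : rat) : (0 <= q)%R ->
    (forall A, ((\sum_(v in A) #|nb A v|)%:R <= q * #|A|%:R)%R) ->
  (mad G <= q)%R.
Proof.
move=> q0 le_q; apply/bigmax_leP; split=> // -[A F].
case/and3P=> /= A0 /subsetP FE /forall_inP FA.
rewrite /average_degree /= ler_pdivrMr ?ltr0n ?card_gt0 //.
apply: le_trans (le_q A); rewrite handshake -natrM ler_nat leq_mul2l /=.
by apply/subset_leq_card/subsetP => e eF; rewrite inE FE //= FA.
Qed.

End MaximumAverageDegree.

(** * The upper bounds *)

Lemma odd_coloring_on (G : graph) (C : finType) (c : G -> C) :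
  odd_on [set: G] c = odd_coloring c.
Proof.
rewrite /odd_on /odd_coloring; congr (_ && _).
  apply: eq_forallb => u; rewrite inE /=; apply: eq_forallb => v; by rewrite inE.
by apply: eq_forallb => v; rewrite inE /= /has_odd /nb setIT.
Qed.

Lemma exists_critical (G : graph) k : 0 < k -> k < chi_o G ->
  exists D : {set G}, [/\ D != set0, ~~ colorable 'I_k D &
    forall X : {set G}, X \proper D -> colorable 'I_k X].
Proof.
move=> k0; rewrite /chi_o; case: ex_minnP => m _ m_min km.
have uncol : ~~ colorable 'I_k [set: G].
  apply/negP => /existsP[c col]; move: km; rewrite ltnNge m_min //.
  by apply/existsP; exists c; rewrite -odd_coloring_on.
have [D /minsetP[D_uncol D_min] _] :=
  @minset_exists _ (fun D => ~~ colorable 'I_k D) _ uncol.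
exists D; split=> // [|X XD].
  apply: contraNneq D_uncol => ->; apply/existsP; exists [ffun _ => Ordinal k0].
  by apply/odd_onP; split=> [u v|v]; rewrite inE.
apply: contraT => X_uncol; have eqXD := D_min X X_uncol (proper_sub XD).
by rewrite eqXD properxx in XD.
Qed.

Lemma chi_o_le6 (G : graph) : (mad G < 3)%R -> chi_o G <= 6.
Proof.
apply: contraTT; rewrite -ltnNge => /exists_critical[//|D [D0 D_uncol D_min]].
rewrite -leNgt; apply: le_trans (mad_ge D0).
rewrite ler_pdivlMr ?ltr0n ?card_gt0 // -natrM ler_nat.
by apply: (critical_average3 _ D_uncol D_min); rewrite card_ord.
Qed.

Lemma chi_o_le5 (G : graph) : (mad G < 20 / 7)%R -> chi_o G <= 5.
Proof.
apply: contraTT; rewrite -ltnNge => /exists_critical[//|D [D0 D_uncol D_min]].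
have D_gt0 : (0 < #|D|%:R :> rat)%R by rewrite ltr0n card_gt0.
have := critical_average20_7 _ D_uncol D_min (card_ord 5).
rewrite card_ord => /(_ isT); rewrite -(ler_nat rat) !natrM => avg.
rewrite -leNgt; apply: le_trans (mad_ge D0).
rewrite ler_pdivlMr; last exact: D_gt0.
by lra.
Qed.

(** * Subdivided complete graphs *)

Section SubdividedComplete.
Variable n : nat.

Definition sub_edge := {e : {set 'I_n} | #|e| == 2}.

Definition sub_adj (x y : 'I_n + sub_edge) : bool :=
  match x, y with
  | inl i, inr e => i \in val e
  | inr e, inl i => i \in val e
  | _, _ => false
  end.

Lemma sub_adj_sym : symmetric sub_adj. Proof. by move=> [i|e] [j|f]. Qed.
Lemma sub_adj_irr : irreflexive sub_adj. Proof. by case. Qed.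

Lemma card_sub_edge : #|{: sub_edge}| = 'C(n, 2).
Proof.
rewrite card_sig -[n in RHS]card_ord -card_draws.
by apply: eq_card => e; rewrite !inE.
Qed.

Hypothesis n_gt0 : 0 < n.

Lemma sub_vertex_gt0 : 0 < #|{: 'I_n + sub_edge}|.
Proof. by rewrite card_sum card_ord addn_gt0 n_gt0. Qed.

Definition subdivided_complete : graph := Graph sub_adj_sym sub_adj_irr sub_vertex_gt0.

Local Notation S := subdivided_complete.

Definition branch : {set S} := [set x : S | if x is inl _ then true else false].

(** The subdivision vertex of ij has exactly the neighbours i and j, so one
    colour is odd there only if i and j differ in colour. *)
Lemma chi_o_subdivided : n <= chi_o S.
Proof.
rewrite /chi_o; case: ex_minnP => k /existsP[c /andP[prop_c odd_c]] _.
suff inj_c : injective (fun i : 'I_n => c (inl i)).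
  by rewrite -[n]card_ord -[k]card_ord; apply: leq_card inj_c.
move=> i j cij; apply/eqP; apply: contraT => i_j.
have cij2 : #|[set i; j]| == 2 by rewrite cards2 i_j.
pose e : S := inr (exist _ [set i; j] cij2).
have nbe : nbhd e = [set (inl i : S); (inl j : S)].
  by apply/setP => -[l|f]; rewrite !inE //; apply: in_set2.
have nbe0 : nbhd e != set0.
  by apply/set0Pn; exists (inl i : S); rewrite nbe !inE eqxx.
have /implyP/(_ nbe0)/existsP[a] := forallP odd_c e; rewrite nbe.
set A := [set u in _ | _].
have [ca|ca] := eqVneq (c (inl i)) a.
  rewrite (_ : A = [set (inl i : S); (inl j : S)]) ?cards2.
    by rewrite (inj_eq (@inl_inj _ _)) i_j.
  apply/setP => x; rewrite !inE andb_idr // => /orP[] /eqP ->; rewrite ?ca //.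
  by rewrite -cij ca.
rewrite (_ : A = set0) ?cards0 //; apply/setP => x; rewrite !inE.
apply/negbTE/negP => /andP[/orP[] /eqP -> /eqP cxa]; first by rewrite cxa eqxx in ca.
by rewrite cij cxa eqxx in ca.
Qed.

(** The graph is bipartite, so each side counts every edge once. *)
Lemma sum_nb_subdivided (A : {set S}) :
  \sum_(v in A) #|nb A v| = 2 * \sum_(v in A | v \in branch) #|nb A v| /\
  \sum_(v in A) #|nb A v| = 2 * \sum_(v in A | v \notin branch) #|nb A v|.
Proof.
have bip : \sum_(v in A | v \in branch) #|nb A v| =
           \sum_(v in A | v \notin branch) #|nb A v|.
  transitivity (\sum_(v in A | v \in branch) #|[set u in nb A v | u \notin branch]|).
    apply: eq_bigr => -[i|e]; rewrite !inE ?andbF // => _; apply: eq_card => -[j|f];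
    by rewrite !inE ?andbF ?andbT.
  rewrite (double_count A (fun v => v \in branch) (fun v => v \notin branch)).
  apply: eq_bigr => -[i|e]; rewrite !inE ?andbF // => _; apply: eq_card => -[j|f];
  by rewrite !inE ?andbF ?andbT.
by rewrite (bigID (fun v => v \in branch)) /= bip addnn -mul2n; split.
Qed.

Lemma card_nbhd_branch v : v \in branch -> #|nbhd v| <= n.-1.
Proof.
case: v => [i _|e]; last by rewrite inE.
pose ends (x : S) : {set 'I_n} := if x is inr e then val e else set0.
(* A subdivision vertex is determined by the pair of its ends. *)
rewrite -(card_in_imset (f := ends)) => [|[j|e] [k|f]]; rewrite ?inE //=; last first.
  by move=> _ _ /val_inj ->.
apply: (@leq_trans #|[set [set i; j] | j in [set~ i]]|).
  apply/subset_leq_card/subsetP => s /imsetP[[j|[e e2]]]; rewrite inE //= => ie ->{s}.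
  case/cards2P: e2 ie => x [y [xy ->]]; rewrite !inE.
  case/orP => /eqP ->; first by apply: imset_f; rewrite !inE eq_sym.
  by rewrite setUC; apply: imset_f; rewrite !inE.
by rewrite (leq_trans (leq_imset_card _ _)) // cardsC1 card_ord.
Qed.

Lemma card_nbhd_subdivision v : v \notin branch -> #|nbhd v| = 2.
Proof.
case: v => [i|[e e2] _]; first by rewrite inE.
rewrite -[RHS](eqP e2) -(card_imset (mem e) (@inl_inj 'I_n sub_edge)).
apply: eq_card => -[j|f]; rewrite !inE /=; first by rewrite mem_imset //; apply: inl_inj.
by apply/esym/negbTE/imsetP => -[].
Qed.

(** A subgraph with l branch vertices, r subdivision vertices and E edges has
    E <= (n - 1) l and E <= 2 r; weighting these by 4 and 2 (n - 1) gives
    2 (n + 1) E <= 4 (n - 1) (l + r).  The whole graph attains equality. *)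
Lemma mad_subdivided : mad S = ((4 * n.-1)%:R / n.+1%:R)%R.
Proof.
have n1 : (0 < n.+1%:R :> rat)%R by rewrite ltr0n.
apply: le_anti; apply/andP; split.
  apply: mad_le => [|A]; first by rewrite divr_ge0 ?ler0n.
  rewrite mulrAC ler_pdivlMr // -!natrM ler_nat.
  have [sumL sumR] := sum_nb_subdivided A.
  have leL : \sum_(v in A | v \in branch) #|nb A v| <= #|A :&: branch| * n.-1.
    rewrite -sum_nat_const.
    rewrite [leqRHS](eq_bigl (fun v => (v \in A) && (v \in branch))) => [|v];
      last by rewrite inE.
    apply: leq_sum => v /andP[_ /card_nbhd_branch]; apply: leq_trans.
    by rewrite subset_leq_card // subsetIl.
  have leR : \sum_(v in A | v \notin branch) #|nb A v| <= #|A :\: branch| * 2.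
    rewrite -sum_nat_const.
    rewrite [leqRHS](eq_bigl (fun v => (v \in A) && (v \notin branch))) => [|v];
      last by rewrite inE andbC.
    apply: leq_sum => v /andP[_ /card_nbhd_subdivision <-].
    by rewrite subset_leq_card // subsetIl.
  rewrite -(cardsID branch A); move: leL leR; rewrite -ltnS; nia.
have S0 : [set: S] != set0 by rewrite -card_gt0 cardsT sub_vertex_gt0.
apply: le_trans (mad_ge S0).
have [_ ->] := sum_nb_subdivided [set: S].
have cardR : \sum_(v in [set: S] | v \notin branch) #|nb [set: S] v| = 'C(n, 2) * 2.
  rewrite -card_sub_edge -(card_imset predT (@inr_inj 'I_n sub_edge)) -sum_nat_const.
  apply: eq_big => [[i|e]|v]; rewrite ?inE /=.
  - by apply/esym/negbTE/imsetP => -[].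
  - by rewrite imset_f.
  by move=> vR; rewrite /nb setIT card_nbhd_subdivision // inE.
rewrite cardR cardsT card_sum card_ord card_sub_edge.
rewrite ler_pdivrMr // mulrAC ler_pdivlMr ?ltr0n ?addn_gt0 ?n_gt0 // -!natrM ler_nat.
have bin2n : 'C(n, 2) * 2 = n * n.-1.
  by rewrite -[LHS]/('C(n, 2) * 2`!) bin_ffact !ffactnS muln1.
by apply/eq_leq; nia.
Qed.

End SubdividedComplete.

Theorem theorem2 :
  (forall G : graph,
     ((mad G < 3)%R -> chi_o G <= 6) /\
     ((mad G < 20 / 7)%R -> chi_o G <= 5)) /\
  (exists G : graph, (mad G < 3)%R /\ chi_o G = 6) /\
  (exists G : graph, (mad G < 20 / 7)%R /\ chi_o G = 5) /\
  (exists G : graph, mad G = 3%R /\ 6 < chi_o G) /\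
  (exists G : graph, mad G = (20 / 7)%R /\ 5 < chi_o G).
Proof.
split; first by move=> G; split; [apply: chi_o_le6 | apply: chi_o_le5].
have n5 : 0 < 5 by []. have n6 : 0 < 6 by []. have n7 : 0 < 7 by [].
split; [|split; [|split]].
- exists (subdivided_complete n6).
  have lt3 : (mad (subdivided_complete n6) < 3)%R by rewrite mad_subdivided.
  by split=> //; apply/eqP; rewrite eqn_leq chi_o_le6 ?chi_o_subdivided.
- exists (subdivided_complete n5).
  have lt20_7 : (mad (subdivided_complete n5) < 20 / 7)%R by rewrite mad_subdivided.
  by split=> //; apply/eqP; rewrite eqn_leq chi_o_le5 ?chi_o_subdivided.
- exists (subdivided_complete n7); split; last exact: chi_o_subdivided.
  by rewrite mad_subdivided; apply/eqP.
exists (subdivided_complete n6); split; last exact: chi_o_subdivided.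
by rewrite mad_subdivided; apply/eqP.
Qed.
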